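(* Let $\{S_j\}_{j=1}^N$ be an iterated function system of contractive similitudes on $\mathbb R^d$ with self-similar set $K$, let $\kappa>0$, and let $(X,\mathcal E)$ be the augmented tree induced by $\{S_j\}_{j=1}^N$. Then $(X,\mathcal E)$ is of bounded degree if and only if $\{S_j\}_{j=1}^N$ satisfies the open set condition.
   Context: $K$ is the unique nonempty compact set with $K=\bigcup_{j=1}^N S_j(K)$. Let $r_j\in(0,1)$ be the contraction ratio of $S_j$ and $r=\min\{r_1,\dots,r_N\}$. $\Sigma^*=\bigcup_{n\ge0}\{1,\dots,N\}^n$ is the set of finite words, $\vartheta$ the empty word; for $x=i_1\cdots i_k\in\Sigma^*$, $S_x=S_{i_1}\circ\cdots\circ S_{i_k}$ ($S_\vartheta=\mathrm{id}$), $r_x=r_{i_1}\cdots r_{i_k}$ ($r_\vartheta=1$), $K_x=S_x(K)$. Let $\mathcal J_0=\{\vartheta\}$ and, for $n\ge1$, $$\mathcal J_n=\{i_1\cdots i_k\in\Sigma^*: r_{i_1\cdots i_k}\le r^n<r_{i_1\cdots i_{k-1}}\},\qquad X=\bigcup_{n\ge0}\mathcal J_n .$$ For $x\in\mathcal J_n$ write $|x|=n$. For $x\in\mathcal J_n$, $n\ge1$, let $x^{-1}$ be the initial segment of $x$ that lies in $\mathcal J_{n-1}$. Vertical edges: $\mathcal E_v=\{(x,x^{-1}),(x^{-1},x):x\in X\setminus\{\vartheta\}\}$, which makes $(X,\mathcal E_v)$ a tree with root $\vartheta$. Horizontal edges: for a fixed $\kappa>0$, $$\mathcal E_h=\{(x,y)\in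 X\times X:|x|=|y|,\ x\ne y,\ \mathrm{dist}(K_x,K_y)\le\kappa r^{|x|}\},$$ where $\mathrm{dist}(E,F)=\inf\{|a-b|:a\in E,b\in F\}$. The augmented tree is $(X,\mathcal E)$ with $\mathcal E=\mathcal E_v\cup\mathcal E_h$. A graph is of bounded degree if $\sup_{x}\deg(x)<\infty$, where $\deg(x)=\#\{y:(x,y)\in\mathcal E\}$. $\{S_j\}_{j=1}^N$ satisfies the open set condition if there is a bounded nonempty open set $O\subset\mathbb R^d$ with $\bigcup_{j=1}^NS_j(O)\subset O$ and the sets $S_j(O)$ pairwise disjoint. *)

(* Defs.v *)
From HB Require Import structures.
From mathcomp Require Import all_boot all_order all_algebra.
From mathcomp Require Import all_classical all_reals all_analysis.

Set Implicit Arguments.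
Unset Strict Implicit.
Unset Printing Implicit Defensive.

Import Order.TTheory GRing.Theory Num.Theory.
Import numFieldNormedType.Exports.

Local Open Scope classical_set_scope.
Local Open Scope ring_scope.

(* The library norm `|x| on row vectors is the sup norm.  Similitudes and
   distances between sets depend on the norm and use the Euclidean one;
   [compact], [open] and [bounded_set] do not depend on the choice. *)
Definition enorm (R : realType) (d : nat) (x : 'rV[R]_d) : R :=
  Num.sqrt (\sum_(i < d) x 0 i ^+ 2).

Definition set_dist (R : realType) (d : nat) (E F : set 'rV[R]_d) : R :=
  inf [set enorm (a - b) | a in E & b in F].

Definition contractive_similitude (R : realType) (d : nat) (c : R)
    (f : 'rV[R]_d -> 'rV[R]_d) : Prop :=
  0 < c < 1 /\ forall x y, enorm (f x - f y) = c * enorm (x - y).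

Definition self_similar_set (R : realType) (d N : nat)
    (S : 'I_N -> 'rV[R]_d -> 'rV[R]_d) (K : set 'rV[R]_d) : Prop :=
  [/\ compact K, K !=set0 & K = \bigcup_(j in [set: 'I_N]) (S j @` K)].

Definition open_set_condition (R : realType) (d N : nat)
    (S : 'I_N -> 'rV[R]_d -> 'rV[R]_d) : Prop :=
  exists O : set 'rV[R]_d,
    [/\ bounded_set O, O !=set0, open O,
        \bigcup_(j in [set: 'I_N]) (S j @` O) `<=` O &
        trivIset [set: 'I_N] (fun j => S j @` O)].

(* Finite words over the alphabet {1, ..., N} are sequences over 'I_N, the
   empty word being [::]. *)
Definition word_map (R : realType) (d N : nat)
    (S : 'I_N -> 'rV[R]_d -> 'rV[R]_d) (x : seq 'I_N) :
    'rV[R]_d -> 'rV[R]_d :=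
  foldr (fun j f => S j \o f) id x.

Definition word_ratio (R : realType) (N : nat) (rho : 'I_N -> R)
    (x : seq 'I_N) : R :=
  \prod_(j <- x) rho j.

(* All ratios are < 1, so for N > 0 the default value 1 does not affect the
   minimum. *)
Definition min_ratio (R : realType) (N : nat) (rho : 'I_N -> R) : R :=
  \big[Num.min/1]_(j < N) rho j.

(* The sets J_n; in the second case, x = i_1 ... i_k and w = i_1 ... i_{k-1}. *)
Definition level (R : realType) (N : nat) (rho : 'I_N -> R) (n : nat) :
    set (seq 'I_N) :=
  if n is 0%N then [set [::]]
  else [set x | exists w i, x = rcons w i /\
         word_ratio rho x <= min_ratio rho ^+ n < word_ratio rho w].

Definition vertices (R : realType) (N : nat) (rho : 'I_N -> R) :
    set (seq 'I_N) :=
  \bigcup_n level rho n.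

(* y = x^{-1} *)
Definition is_parent (R : realType) (N : nat) (rho : 'I_N -> R)
    (y x : seq 'I_N) : Prop :=
  exists n, [/\ level rho n.+1 x, level rho n y & prefix y x].

Definition vertical_edges (R : realType) (N : nat) (rho : 'I_N -> R) :
    set (seq 'I_N * seq 'I_N) :=
  [set e | is_parent rho e.1 e.2 \/ is_parent rho e.2 e.1].

(* The levels are pairwise disjoint, so n below is both |x| and |y|. *)
Definition horizontal_edges (R : realType) (d N : nat)
    (S : 'I_N -> 'rV[R]_d -> 'rV[R]_d) (rho : 'I_N -> R)
    (K : set 'rV[R]_d) (kappa : R) : set (seq 'I_N * seq 'I_N) :=
  [set e | exists n, [/\ level rho n e.1, level rho n e.2, e.1 <> e.2 &
    set_dist (word_map S e.1 @` K) (word_map S e.2 @` K)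
      <= kappa * min_ratio rho ^+ n]].

Definition augmented_tree_edges (R : realType) (d N : nat)
    (S : 'I_N -> 'rV[R]_d -> 'rV[R]_d) (rho : 'I_N -> R)
    (K : set 'rV[R]_d) (kappa : R) : set (seq 'I_N * seq 'I_N) :=
  vertical_edges rho `|` horizontal_edges S rho K kappa.

Definition degree (R : realType) (T : choiceType) (E : set (T * T)) (x : T) :
    \bar R :=
  counting [set y | E (x, y)].

Definition bounded_degree (R : realType) (T : choiceType) (V : set T)
    (E : set (T * T)) : Prop :=
  (ereal_sup [set degree R E x | x in V] < +oo)%E.

(* Main.v *)
Require Import Defs.
From HB Require Import structures.
From mathcomp Require Import all_boot all_order all_algebra.
From mathcomp Require Import all_classical all_reals all_analysis.
From mathcomp Require Import ring lra.

Set Implicit Arguments.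
Unset Strict Implicit.
Unset Printing Implicit Defensive.

Import Order.TTheory GRing.Theory Num.Theory.
Import numFieldNormedType.Exports.

Local Open Scope classical_set_scope.
Local Open Scope ring_scope.

(* If the open set condition holds with O containing a ball around o, then for
   words y in one level the sets S_y(O) are disjoint, so the points S_y(o) are
   separated by a multiple of r^n; a grid count bounds how many of them lie near
   K_x.  Conversely (Schief's argument), bounded degree bounds the number of
   words i of size comparable to a word k with K_i within kappa * r_k of K_k.
   For k maximizing that number, every such neighbour of u k starts with u.
   Hence K_{a u k} and K_{b v k} are far apart when a != b, and the union over u
   of the (kappa r_{uk} / 2)-neighbourhoods of K_{uk} is a feasible open set. *)

(** * Euclidean norm and distance between sets *)

Section EuclideanNorm.
Variables (R : realType) (d : nat).
Implicit Types (x y z : 'rV[R]_d) (e : R).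

Lemma enorm_ge0 x : 0 <= enorm x.
Proof. exact: sqrtr_ge0. Qed.

Lemma sqr_enorm x : enorm x ^+ 2 = \sum_(i < d) x 0 i ^+ 2.
Proof. by rewrite sqr_sqrtr// sumr_ge0// => i _; rewrite sqr_ge0. Qed.

Lemma enorm0 : enorm (0 : 'rV[R]_d) = 0.
Proof. by rewrite /enorm big1 ?sqrtr0// => i _; rewrite mxE expr0n. Qed.

Lemma enormN x : enorm (- x) = enorm x.
Proof. by congr Num.sqrt; apply: eq_bigr => i _; rewrite mxE sqrrN. Qed.

Lemma enormB x y : enorm (x - y) = enorm (y - x).
Proof. by rewrite -enormN opprB. Qed.

Lemma coord_le_enorm x i : `|x 0 i| <= enorm x.
Proof.
rewrite -(ler_pXn2r (n := 2)) ?nnegrE ?enorm_ge0// sqr_enorm real_normK ?num_real//.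
by rewrite (bigD1 i)//= lerDl sumr_ge0// => j _; rewrite sqr_ge0.
Qed.

Lemma enorm_eq0 x : enorm x = 0 -> x = 0.
Proof.
move=> x0; apply/rowP => i; rewrite mxE; apply/eqP.
by rewrite -normr_le0 -x0 coord_le_enorm.
Qed.

Lemma enorm_le_coord x e : (forall i, `|x 0 i| <= e) -> enorm x <= d%:R * e.
Proof.
(* Without coordinates [e] may be negative, but then both sides are 0. *)
move=> xe; case: (posnP d) => [d0|d_gt0].
  rewrite /enorm big1 ?sqrtr0 ?d0 ?mul0r// => i.
  by have := ltn_ord i; rewrite [X in (_ < X)%N]d0.
have e0 : 0 <= e by rewrite (le_trans _ (xe (Ordinal d_gt0))).
rewrite -(ler_pXn2r (n := 2)) ?nnegrE ?enorm_ge0 ?mulr_ge0// sqr_enorm.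
apply: (@le_trans _ _ (\sum_(i < d) e ^+ 2)).
  apply: ler_sum => i _; rewrite -[x 0 i ^+ 2]real_normK ?num_real//.
  by rewrite ler_pXn2r// nnegrE.
rewrite sumr_const card_ord exprMn -[leLHS]mulr_natl ler_wpM2r ?sqr_ge0//.
by rewrite -natrX ler_nat -{1}(expn1 d) leq_pexp2l.
Qed.

Lemma coord_le_norm x i : `|x 0 i| <= `|x|.
Proof.
rewrite [leRHS]/Num.norm /= mx_normrE.
by apply/bigmax_geP; right => /=; exists (ord0, i).
Qed.

Lemma enorm_le_norm x : enorm x <= d%:R * `|x|.
Proof. by apply: enorm_le_coord => i; exact: coord_le_norm. Qed.

Lemma norm_le_enorm x : `|x| <= enorm x.
Proof.
rewrite [leLHS]/Num.norm /= mx_normrE; apply/bigmax_leP; split.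
  exact: enorm_ge0.
by case=> i j _ /=; rewrite ord1 coord_le_enorm.
Qed.

Definition edot x y : R := \sum_(i < d) x 0 i * y 0 i.

Lemma sqr_enormD x y :
  enorm (x + y) ^+ 2 = enorm x ^+ 2 + enorm y ^+ 2 + 2 * edot x y.
Proof.
rewrite !sqr_enorm /edot mulr_sumr -!big_split /=.
by apply: eq_bigr => i _; rewrite mxE; ring.
Qed.

Lemma sqr_enormB x y :
  enorm (x - y) ^+ 2 = enorm x ^+ 2 + enorm y ^+ 2 - 2 * edot x y.
Proof.
rewrite sqr_enormD enormN; congr (_ + _).
rewrite -mulrN; congr (2 * _); rewrite /edot -sumrN.
by apply: eq_bigr => i _; rewrite mxE mulrN.
Qed.

Lemma sqr_enormZ e x : enorm (e *: x) ^+ 2 = e ^+ 2 * enorm x ^+ 2.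
Proof.
by rewrite !sqr_enorm mulr_sumr; apply: eq_bigr => i _; rewrite mxE exprMn.
Qed.

Lemma edotZ e f x y : edot (e *: x) (f *: y) = e * f * edot x y.
Proof.
by rewrite /edot mulr_sumr; apply: eq_bigr => i _; rewrite !mxE; ring.
Qed.

(** Cauchy-Schwarz: the squared norm of [enorm y *: x - enorm x *: y] is [2 * enorm x * enorm y]
    times the difference of the two sides. *)
Lemma edot_le x y : edot x y <= enorm x * enorm y.
Proof.
have [x0|] := eqVneq (enorm x) 0.
  rewrite x0 mul0r (enorm_eq0 x0) /edot big1// => i _.
  by rewrite mxE mul0r.
have [y0 _|ny nx] := eqVneq (enorm y) 0.
  rewrite y0 mulr0 (enorm_eq0 y0) /edot big1// => i _.
  by rewrite mxE mulr0.
have xy0 : 0 < enorm x * enorm y.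
  by rewrite mulr_gt0// lt_def ?nx ?ny enorm_ge0.
have := sqr_ge0 (enorm (enorm y *: x - enorm x *: y)).
rewrite sqr_enormB !sqr_enormZ edotZ => h.
by rewrite -subr_ge0 -(pmulr_lge0 _ xy0); nra.
Qed.

Lemma enormD x y : enorm (x + y) <= enorm x + enorm y.
Proof.
rewrite -(ler_pXn2r (n := 2)) ?nnegrE ?addr_ge0 ?enorm_ge0//.
by rewrite sqr_enormD; have := edot_le x y; nra.
Qed.

Lemma enorm_triangle y x z : enorm (x - z) <= enorm (x - y) + enorm (y - z).
Proof. by have := enormD (x - y) (y - z); rewrite addrA subrK. Qed.

Lemma set_dist_le (E F : set 'rV[R]_d) x y :
  E x -> F y -> set_dist E F <= enorm (x - y).
Proof.
move=> Ex Fy; apply: ge_inf; last by exists x => //; exists y.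
by exists 0 => _ [a _ [b _ <-]]; exact: enorm_ge0.
Qed.

(** The infimum need not be attained, hence the strict bound. Nonemptiness excludes the default
    value 0 of [inf]. *)
Lemma set_dist_adherent (E F : set 'rV[R]_d) e : E !=set0 -> F !=set0 ->
  set_dist E F < e -> exists x y, [/\ E x, F y & enorm (x - y) < e].
Proof.
move=> [a Ea] [b Fb] EFe.
have hi : has_inf [set enorm (a - b) | a in E & b in F].
  split; first by exists (enorm (a - b)), a => //; exists b.
  by exists 0 => _ [u _ [v _ <-]]; exact: enorm_ge0.
have [|_ [x Ex [y Fy <-]]] := inf_adherent (eps := e - set_dist E F) _ hi.
  by rewrite subr_gt0.
by rewrite /set_dist => xy; exists x, y; split=> //; lra.
Qed.

End EuclideanNorm.

(** * Bijectivity of similitudes *)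

Section Similitudes.
Variables (R : realType) (d : nat) (c : R) (f : 'rV[R]_d -> 'rV[R]_d).
Hypothesis c_gt0 : 0 < c.
Hypothesis f_sim : forall x y, enorm (f x - f y) = c * enorm (x - y).

Lemma similitude_inj : injective f.
Proof.
move=> x y fxy; apply/eqP; rewrite -subr_eq0; apply/eqP/enorm_eq0.
have := f_sim x y; rewrite fxy subrr enorm0 => /esym/eqP.
by rewrite mulf_eq0 gt_eqF//= => /eqP.
Qed.

(* g := f - f(0) preserves inner products up to the factor c^2, so the matrix M
   of the images of the basis satisfies M M^T = c^2, and g x - x M is orthogonal
   to the rows of M. *)
Lemma similitude_surj z : exists x, f x = z.
Proof.
pose g x := f x - f 0.
have g_norm x : enorm (g x) = c * enorm x by rewrite f_sim subr0.
have g_dot x y : edot (g x) (g y) = c ^+ 2 * edot x y.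
  have := sqr_enormB (g x) (g y); have := sqr_enormB x y.
  have -> : g x - g y = f x - f y by rewrite /g opprB addrA subrK.
  rewrite f_sim !g_norm !exprMn; nra.
pose M : 'M[R]_d := \matrix_(i < d) g (delta_mx 0 i).
have dot_delta (x : 'rV[R]_d) i : edot x (delta_mx 0 i) = x 0 i.
  rewrite /edot (bigD1 i)//= big1 ?addr0; first by rewrite mxE !eqxx mulr1.
  by move=> j ji; rewrite mxE eqxx (negPf ji) mulr0.
have gMT x : g x *m M^T = c ^+ 2 *: x.
  apply/rowP => i; rewrite !mxE -(dot_delta x) -g_dot.
  by apply: eq_bigr => j _; rewrite !mxE.
have MMT : M *m M^T = (c ^+ 2)%:M.
  by apply/row_matrixP => i; rewrite row_mul rowK gMT rowE mul_mx_scalar.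
have c2 : c ^+ 2 != 0 by rewrite expf_neq0// gt_eqF.
have MTu : M^T \in unitmx.
  have : (c ^- 2 *: M) *m M^T = 1%:M.
    by rewrite -scalemxAl MMT scale_scalar_mx mulVf.
  by case/mulmx1_unit.
exists (c ^- 2 *: ((z - f 0) *m M^T)).
apply: (addIr (- f 0)); apply: (can_inj (mulmxK MTu)).
by rewrite -/(g _) gMT scalerA mulfV// scale1r.
Qed.

End Similitudes.

(** * Cardinality bounds and bounded degree *)

Section Enumerations.

(** The list may repeat elements and leave [A], so unions and products of bounds become operations
    on lists. *)
Definition enum_le (T : eqType) (M : nat) (A : set T) :=
  exists2 s : seq T, (size s <= M)%N & A `<=` [set` s].

Lemma enum_leU (T : eqType) (M M' : nat) (A B : set T) :
  enum_le M A -> enum_le M' B -> enum_le (M + M') (A `|` B).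
Proof.
move=> [s sM As] [t tM Bt]; exists (s ++ t); first by rewrite size_cat leq_add.
by move=> x [/As|/Bt] /= xs; rewrite mem_cat xs ?orbT.
Qed.

Lemma sub_enum_le (T : eqType) (M : nat) (A B : set T) :
  A `<=` B -> enum_le M B -> enum_le M A.
Proof. by move=> AB [s sM Bs]; exists s => // x /AB /Bs. Qed.

Lemma enum_le_inj (T : choiceType) (F : finType) (f : T -> F) (A : set T) :
  {in A &, injective f} -> enum_le #|F| A.
Proof.
move=> f_inj; have [[x0 _]|A0] := pselect (A !=set0); last first.
  by exists [::] => // x Ax; case: A0; exists x.
(* One chosen preimage per value; a value without preimage in [A] yields the harmless default
   [x0]. *)
exists [seq xget x0 [set y | A y /\ f y = c] | c <- enum F].
  by rewrite size_map -cardE.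
move=> x Ax; apply/mapP; exists (f x); first by rewrite mem_enum.
have [|Ay fy] := @xgetPex _ x0 [set y | A y /\ f y = f x]; first by exists x.
by apply: f_inj; rewrite ?inE// fy.
Qed.

Lemma bounded_degreeP (R : realType) (T : choiceType) (V : set T)
    (E : set (T * T)) :
  bounded_degree R V E <->
  exists M, forall x, V x -> enum_le M [set y | E (x, y)].
Proof.
split=> [bE|[M VM]]; last first.
  apply: (@le_lt_trans _ _ M%:R%:E); last exact: ltry.
  apply: ge_ereal_sup => _ [x Vx <-]; rewrite /degree /counting.
  have [s sM Es] := VM x Vx.
  have fE : finite_set [set y | E (x, y)] by apply: sub_finite_set Es _.
  rewrite asboolT// lee_fin ler_nat (leq_trans _ sM)//.
  apply: uniq_leq_size; first exact: finmap.fset_uniq.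
  by move=> y; rewrite in_fset_set// inE => /Es.
have deg_le x : V x -> (degree R E x <= ereal_sup [set degree R E x | x in V])%E.
  by move=> Vx; apply: ereal_sup_ubound; exists x.
(* An integer above the supremum. For a vertex [x], an infinite neighbour set would force the value
   [+oo], and a finite degree excludes [-oo]. *)
exists (Num.truncn (fine (ereal_sup [set degree R E x | x in V]))).+1 => x Vx.
have := deg_le _ Vx; rewrite /degree /counting.
case: asboolP => [fE|_]; last by rewrite leye_eq => /eqP eE; rewrite /bounded_degree eE in bE.
move=> le_s; exists (finmap.enum_fset (fset_set [set y | E (x, y)])); last first.
  by move=> y Ey /=; rewrite in_fset_set// inE.
rewrite -(ler_nat R) ltW//; apply: le_lt_trans (truncnS_gt _).
rewrite -lee_fin fineK//; rewrite fin_numE; apply/andP; split.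
  by rewrite gt_eqF// (lt_le_trans _ le_s)// ltNyr.
by rewrite lt_eqF.
Qed.

End Enumerations.

(** * Counting separated points in a ball *)

Section Packing.
Variables (R : realType) (d : nat) (T : choiceType).

(* Pigeonhole on a grid of mesh [delta * t / d.+1]. *)
Lemma packing (C delta : R) : 0 < C -> 0 < delta ->
  exists M, forall (A : set T) (h : T -> 'rV[R]_d) (q : 'rV[R]_d) (t : R),
    0 < t -> (forall y, A y -> enorm (h y - q) <= C * t) ->
    (forall y z, A y -> A z -> enorm (h y - h z) < delta * t -> y = z) ->
    enum_le M A.
Proof.
(* Points in one cell of side [e * t] are at distance at most [d%:R * e * t]; the divisor [d.+1]
   makes this strictly less than [delta * t]. *)
move=> C0 delta0; pose e := delta / d.+1%:R.
have e0 : 0 < e by rewrite divr_gt0.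
pose L := Num.truncn (2 * C / e).
exists #|{ffun 'I_d -> 'I_L.+1}| => A h q t t0 hC hd.
(* Rescaled coordinates lie between 0 and [2 * C / e], so the number of cells does not depend on
   [t]. *)
pose s y i := (h y 0 i - q 0 i + C * t) / (e * t).
have et0 : 0 < e * t by rewrite mulr_gt0.
have s_bnd y i : A y -> 0 <= s y i /\ (Num.truncn (s y i) < L.+1)%N.
  move=> Ay; have := coord_le_enorm (h y - q) i; rewrite !mxE => /le_trans.
  move=> /(_ _ (hC y Ay)); rewrite ler_norml => /andP[lo hi].
  have s0 : 0 <= s y i by apply: divr_ge0; [lra|exact: ltW].
  split=> //; rewrite truncn_lt_nat//; apply: le_lt_trans (truncnS_gt _).
  rewrite /s ler_pdivrMr// [leRHS]mulrA divfK ?gt_eqF//; lra.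
apply: (@enum_le_inj _ _ (fun y => [ffun i => inord (Num.truncn (s y i))])).
move=> y z; rewrite !inE => Ay Az /ffunP yz; apply: hd => //.
apply: (@le_lt_trans _ _ (d%:R * (e * t))).
  apply: enorm_le_coord => i; rewrite !mxE.
  have [sy0 syL] := s_bnd y i Ay; have [sz0 szL] := s_bnd z i Az.
  have := yz i; rewrite !ffunE => /(congr1 val) /=; rewrite !inordK// => eq_t.
  have := truncn_itv sy0; rewrite eq_t; have := truncn_itv sz0.
  rewrite -natr1; set m := (_ %:R : R) => /andP[mz zm] /andP[my ym].
  have : `|s y i - s z i| <= 1 by rewrite ler_norml; lra.
  have -> : s y i - s z i = (h y 0 i - h z 0 i) / (e * t).
    by rewrite /s -mulrBl; congr (_ / _); ring.
  by rewrite normrM normfV (gtr0_norm et0) ler_pdivrMr// mul1r.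
rewrite mulrA ltr_pM2r// /e mulrCA -[ltRHS]mulr1 ltr_pM2l//.
by rewrite ltr_pdivrMr// mul1r ltr_nat.
Qed.

End Packing.

(** * Ratios and levels of words *)

Section Words.
Variables (R : realType) (N : nat) (rho : 'I_N -> R).
Hypothesis rho01 : forall j, 0 < rho j < 1.
Implicit Types (x y z w u v : seq 'I_N) (a b i j : 'I_N).

Local Notation ratio := (word_ratio rho).
Local Notation r := (min_ratio rho).

Lemma ratio_nil : ratio [::] = 1.
Proof. by rewrite /word_ratio big_nil. Qed.

Lemma ratio_cons a x : ratio (a :: x) = rho a * ratio x.
Proof. by rewrite /word_ratio big_cons. Qed.

Lemma ratio_cat x y : ratio (x ++ y) = ratio x * ratio y.
Proof. by rewrite /word_ratio big_cat. Qed.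

Lemma ratio_rcons x a : ratio (rcons x a) = ratio x * rho a.
Proof. by rewrite -cats1 ratio_cat ratio_cons ratio_nil mulr1. Qed.

Lemma ratio_gt0 x : 0 < ratio x.
Proof. by apply: prodr_gt0 => j _; case/andP: (rho01 j). Qed.

Lemma ratio_le1 x : ratio x <= 1.
Proof.
elim: x => [|a x IH]; first by rewrite ratio_nil.
by case/andP: (rho01 a) => a0 a1; rewrite ratio_cons mulr_ile1// ltW// ratio_gt0.
Qed.

Lemma ratio_lt1 x : x != [::] -> ratio x < 1.
Proof.
case: x => // a x _; rewrite ratio_cons; have := ratio_le1 x.
by case/andP: (rho01 a) => a0 a1; have := ratio_gt0 x; nra.
Qed.

Lemma min_ratio_gt0 : 0 < r.
Proof.
rewrite /min_ratio; elim/big_rec: _ => // j y _ y0.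
by rewrite lt_min y0 andbT; case/andP: (rho01 j).
Qed.

Lemma min_ratio_le j : r <= rho j.
Proof. exact: bigmin_le. Qed.

Lemma min_ratio_lt1 : (0 < N)%N -> r < 1.
Proof.
move=> N0; apply: le_lt_trans (min_ratio_le (Ordinal N0)) _.
by case/andP: (rho01 (Ordinal N0)).
Qed.

Lemma min_ratioX_gt0 n : 0 < r ^+ n.
Proof. by rewrite exprn_gt0 ?min_ratio_gt0. Qed.

(** One letter costs at most the factor [r]; thus a word cut at threshold [t] has ratio comparable
    to [t]. *)
Lemma ratio_rcons_gt w a (t : R) : t < ratio w -> t * r < ratio (rcons w a).
Proof.
move=> tw; rewrite ratio_rcons; have := min_ratio_le a.
by have := min_ratio_gt0; have := ratio_gt0 w; nra.
Qed.

(** Last letters are removed as long as the ratio stays at most [t]. Since [t < 1], this stops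
    before the empty word. *)
Lemma cut_prefix (t : R) x : t < 1 -> ratio x <= t -> exists w a v,
  x = rcons w a ++ v /\ ratio (rcons w a) <= t < ratio w.
Proof.
move=> t1; elim/last_ind: x => [|x a IH] xt.
  by move: xt; rewrite ratio_nil leNgt t1.
have [/IH[w [b [v [-> wb]]]]|tx] := leP (ratio x) t.
  by exists w, b, (rcons v a); rewrite rcons_cat.
by exists x, a, [::]; rewrite cats0 xt tx.
Qed.

Lemma level_prefix n x : (0 < N)%N -> ratio x <= r ^+ n ->
  exists w v, x = w ++ v /\ level rho n w.
Proof.
case: n => [|n] N0 xn; first by exists [::], x.
have [||w [a [v [-> wa]]]] := @cut_prefix (r ^+ n.+1) x; last first.
- by exists (rcons w a), v; split=> //; exists w, a.
- by [].
- by rewrite exprn_ilt1 ?min_ratio_lt1// ltW// min_ratio_gt0.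
Qed.

(** The last letter of [x] multiplies a ratio above [r ^+ n] by at least [r]. These intervals are
    disjoint for distinct [n], so the ratio determines the level. *)
Lemma level_ratio n x : (0 < N)%N -> level rho n x -> r ^+ n.+1 < ratio x <= r ^+ n.
Proof.
case: n => [|n] N0 /=.
  by move=> ->; rewrite ratio_nil expr1 expr0 lexx min_ratio_lt1.
move=> [w [a [-> /andP[-> wn]]]]; rewrite andbT exprSr.
exact: ratio_rcons_gt.
Qed.

Lemma level_inj n m x : (0 < N)%N -> level rho n x -> level rho m x -> n = m.
Proof.
move=> N0.
wlog nm : n m / (n < m)%N => [hw nx mx|nx mx].
  by have [?|?|//] := ltngtP n m; [|apply/esym]; exact: hw.
have /andP[rx _] := level_ratio N0 nx; have /andP[_ xr] := level_ratio N0 mx.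
suff /(lt_le_trans rx) : ratio x <= r ^+ n.+1 by rewrite ltxx.
by rewrite (le_trans xr)// ler_wiXn2l// ltW ?min_ratio_gt0 ?min_ratio_lt1.
Qed.

(** If [y] properly extended [x], then [y] without its last letter would still extend [x] and have
    ratio at most [r ^+ n]. *)
Lemma level_antichain n x y : level rho n x -> level rho n y -> prefix x y -> x = y.
Proof.
case: n => [->->//|n] xn yn /prefixP[v]; case/lastP: v => [|v a] yE.
  by rewrite yE cats0.
move: yn => [w [b [yE' /andP[_ wn]]]].
move: yE'; rewrite yE -rcons_cat => /rcons_inj[wE _].
move: xn => [x' [c [_ /andP[xn _]]]]; move: wn; rewrite -wE ratio_cat ltNge.
case/negP; rewrite (le_trans _ xn)//.
by rewrite ler_piMr ?ratio_le1// ltW// ratio_gt0.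
Qed.

Lemma enum_short_words L : exists M, enum_le M [set w : seq 'I_N | (size w <= L)%N].
Proof.
elim: L => [|L [M [s sM IH]]]; first by exists 1%N, [:: [::]] => // -[].
exists (size ([::] :: [seq a :: w | a <- enum 'I_N, w <- s])).
exists ([::] :: [seq a :: w | a <- enum 'I_N, w <- s]) => //.
case=> [|a w] //= wL; rewrite inE /=; apply/allpairsP.
by exists (a, w); split=> //=; rewrite ?mem_enum//; exact: IH.
Qed.

Lemma expr_lt_exists (q e : R) : 0 <= q -> q < 1 -> 0 < e -> exists n, q ^+ n < e.
Proof.
move=> q0 q1 e0.
have /cvgrPdist_lt /(_ e e0) [n _ /(_ n (leqnn n))] : (fun n => q ^+ n) @ \oo --> 0.
  by apply: cvg_expr; rewrite ger0_norm.
by rewrite /= sub0r normrN ger0_norm ?exprn_ge0// => ?; exists n.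
Qed.

Lemma enum_large_words (t : R) : 0 < t -> exists M, enum_le M [set w | t < ratio w].
Proof.
(* [q] is the largest contraction ratio, so [ratio w <= q ^+ size w] and a ratio above [t] bounds
   the length. *)
move=> t0; pose q := \big[Num.max/0]_j rho j.
have q0 : 0 <= q by exact: bigmax_ge_id.
have q1 : q < 1 by apply/bigmax_ltP; split=> // j _; case/andP: (rho01 j).
have [L Lt] := expr_lt_exists q0 q1 t0.
have [M LM] := enum_short_words L; exists M; apply: sub_enum_le LM => w /= tw.
rewrite leqNgt; apply/negP => Lw; move: tw; apply/negP; rewrite -leNgt.
apply: le_trans (ltW Lt); apply: (@le_trans _ _ (q ^+ size w)).
  elim: w {Lw} => [|a w IH]; first by rewrite ratio_nil.
  have /andP[/ltW a0 _] := rho01 a; have /ltW w0 := ratio_gt0 w.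
  by rewrite ratio_cons exprS; apply: ler_pM => //; exact: le_bigmax.
by apply: ler_wiXn2l => //; [exact: ltW|exact: ltnW].
Qed.

(** Take the least [n] satisfying the first inequality: minimality gives the second one, which for
    [n = 0] is [ratio x <= 1]. *)
Lemma ratio_scale x : (0 < N)%N -> exists n, r ^+ n.+1 < ratio x <= r ^+ n.
Proof.
move=> N0; have r0 := min_ratio_gt0.
have ex_n : exists n, r ^+ n.+1 < ratio x.
  have [|||n rn] := @expr_lt_exists r (ratio x); rewrite ?ltW ?min_ratio_lt1//.
    exact: ratio_gt0.
  exists n; apply: le_lt_trans rn.
  by rewrite ler_wiXn2l// ltW ?min_ratio_lt1.
case: (ex_minnP ex_n) => -[|n] rn min_n; first by exists 0%N; rewrite rn ratio_le1.
exists n.+1; rewrite rn leNgt; apply/negP => /min_n.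
by rewrite ltnn.
Qed.

End Words.

(** * Cylinder maps of the iterated function system *)

Section IteratedFunctionSystem.
Variables (R : realType) (d N : nat) (S : 'I_N -> 'rV[R]_d -> 'rV[R]_d).
Variable rho : 'I_N -> R.
Hypothesis N_gt0 : (0 < N)%N.
Hypothesis S_sim : forall j, contractive_similitude (rho j) (S j).
Variable K : set 'rV[R]_d.
Hypothesis K_ss : self_similar_set S K.
Variable kappa : R.
Hypothesis kappa_gt0 : 0 < kappa.
Implicit Types (x y u v w k : seq 'I_N) (a b : 'I_N) (p q z : 'rV[R]_d).

Local Notation ratio := (word_ratio rho).
Local Notation r := (min_ratio rho).
Local Notation Sw := (word_map S).
Local Notation edges := (augmented_tree_edges S rho K kappa).

Let rho01 j : 0 < rho j < 1. Proof. by have [] := S_sim j. Qed.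

Let r_gt0 : 0 < r. Proof. exact: min_ratio_gt0. Qed.

Let r_lt1 : r < 1. Proof. exact: min_ratio_lt1. Qed.

Lemma word_map_cat x y p : Sw (x ++ y) p = Sw x (Sw y p).
Proof. by elim: x => //= a x ->. Qed.

Lemma word_map_sim x p q : enorm (Sw x p - Sw x q) = ratio x * enorm (p - q).
Proof.
elim: x => [|a x IH] /=; first by rewrite ratio_nil mul1r.
by have [_ ->] := S_sim a; rewrite IH ratio_cons mulrA.
Qed.

Lemma word_map_stable x p : K p -> K (Sw x p).
Proof.
move=> Kp; elim: x => //= a x Kx; have [_ _ ->] := K_ss.
by exists a => //; exists (Sw x p).
Qed.

Lemma attractor_bounded : exists2 B, 0 < B & forall p, K p -> enorm p <= B.
Proof.
have [/compact_bounded[B0 [_ KB]] _ _] := K_ss.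
have K1 p : K p -> `|p| <= `|B0| + 1.
  by apply: KB; rewrite (le_lt_trans (ler_norm _))// ltrDl.
exists (d%:R * (`|B0| + 1) + 1); first by rewrite ltr_wpDl// mulr_ge0// addr_ge0.
move=> p /K1 pB; rewrite (le_trans (enorm_le_norm _))//.
by rewrite (@le_trans _ _ (d%:R * (`|B0| + 1))) ?lerDl// ler_wpM2l.
Qed.

(** Injectivity strips the common prefix; the first distinct letters then send the points into
    disjoint images of [O]. *)
Lemma word_map_disjoint (O : set 'rV[R]_d) x y p q :
  \bigcup_(j in [set: 'I_N]) (S j @` O) `<=` O ->
  trivIset [set: 'I_N] (fun j => S j @` O) ->
  ~~ prefix x y -> ~~ prefix y x -> O p -> O q -> Sw x p <> Sw y q.
Proof.
move=> SO tO; have SwO u z : O z -> O (Sw u z).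
  by move=> Oz; elim: u => //= a u Ou; apply: SO; exists a => //; exists (Sw u z).
elim: x y => [|a x IH] [|b y] //=.
have [<-|/eqP ab _ _ Op Oq eq_xy] := eqVneq a b.
  move=> xy yx Op Oq eq_xy; apply: (IH y) => //.
  have /andP[a0 _] := rho01 a; have [_ Sa] := S_sim a.
  exact: (similitude_inj a0 Sa).
apply: ab; apply: (tO a b I I); exists (S a (Sw x p)); split.
  by exists (Sw x p) => //; exact: SwO.
by rewrite eq_xy; exists (Sw y q) => //; exact: SwO.
Qed.

(** * The open set condition implies bounded degree *)

Lemma level_comparable n m x y : (n <= m.+1)%N -> level rho n x ->
  level rho m y -> r ^+ 2 * ratio y <= ratio x.
Proof.
move=> nm nx my; have /andP[xn _] := level_ratio rho01 N_gt0 nx.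
have /andP[_ ym] := level_ratio rho01 N_gt0 my.
apply: le_trans (ltW xn); apply: (@le_trans _ _ (r ^+ m.+2)).
  by rewrite -[m.+2]/(2 + m)%N exprD ler_wpM2l// exprn_ge0// ltW.
by rewrite ler_wiXn2l// ltW.
Qed.

(** Treats all edges alike. Along a vertical edge one cylinder contains the other, so a common point
    exists; along a horizontal edge [r ^+ n < ratio x / r] converts the distance bound. *)
Lemma edge_neighbour n x y : level rho n x -> edges (x, y) ->
  exists m, [/\ level rho m y, [\/ m = n, m = n.+1 | m = n.-1],
    r ^+ 2 * ratio x <= ratio y <= ratio x / r ^+ 2 &
    exists p q, [/\ K p, K q & enorm (Sw y p - Sw x q) <= (kappa + 1) / r * ratio x]].
Proof.
move=> nx; have [_ [p0 Kp0] _] := K_ss; have rn := min_ratioX_gt0 rho01.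
have x0 := ratio_gt0 rho01 x.
have c0 : 0 <= (kappa + 1) / r * ratio x.
  by rewrite mulr_ge0 ?(ltW x0)// divr_ge0 ?(ltW r_gt0)// ltW// addr_gt0.
have close m p q : level rho m y -> (m <= n.+1)%N -> (n <= m.+1)%N ->
    [\/ m = n, m = n.+1 | m = n.-1] -> K p -> K q ->
    enorm (Sw y p - Sw x q) <= (kappa + 1) / r * ratio x ->
  exists m, [/\ level rho m y, [\/ m = n, m = n.+1 | m = n.-1],
    r ^+ 2 * ratio x <= ratio y <= ratio x / r ^+ 2 &
    exists p q, [/\ K p, K q &
      enorm (Sw y p - Sw x q) <= (kappa + 1) / r * ratio x]].
  move=> my mn nm nmE Kp Kq pq; exists m; split=> //; last by exists p, q.
  rewrite (level_comparable mn my nx) ler_pdivlMr ?exprn_gt0// mulrC.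
  exact: level_comparable nm nx my.
case=> [[] [m []]|[m [/= mx my _ xy]]].
- move=> my /(level_inj rho01 N_gt0 nx) nE /prefixP[v /= yE].
  rewrite -{m}nE in my.
  apply: (close _ p0 (Sw v p0) my _ _ (Or32 _ _ erefl)) => //.
  - exact/leqW/leqnSn.
  - exact: word_map_stable.
  by rewrite yE word_map_cat subrr enorm0.
- move=> /(level_inj rho01 N_gt0 nx) nE my /prefixP[v /= xE].
  apply: (close _ (Sw v p0) p0 my) => //; rewrite ?nE//.
  - exact/leqW/leqnSn.
  - by constructor 3.
  - exact: word_map_stable.
  by rewrite {1}xE word_map_cat subrr enorm0.
have nE := level_inj rho01 N_gt0 nx mx; rewrite -{m mx}nE in my xy.
have img w : Sw w @` K !=set0 by exists (Sw w p0), p0.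
(* Passing to [kappa + 1] makes the bound strict, so that actual points realize it. *)
have xy_lt : set_dist (Sw x @` K) (Sw y @` K) < (kappa + 1) * r ^+ n.
  by apply: le_lt_trans xy _; rewrite ltr_pM2r ?ltrDl// rn.
have [_ [_ [[q Kq <-] [p Kp <-] pq]]] := set_dist_adherent (img x) (img y) xy_lt.
apply: (close _ p q my) => //; first by constructor 1.
rewrite enormB (le_trans (ltW pq))// -mulrA ler_wpM2l ?addr_ge0 ?(ltW kappa_gt0)//.
rewrite ler_pdivlMl// -exprS; by have /andP[/ltW] := level_ratio rho01 N_gt0 nx.
Qed.

Lemma osc_bounded_degree :
  open_set_condition S -> bounded_degree R (vertices rho) edges.
Proof.
move=> [U [_ U_neq0 U_open SU tU]]; apply/bounded_degreeP.
case: U_neq0 => o Uo.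
have [B B0 KB] := attractor_bounded; have [_ [p0 Kp0] _] := K_ss.
have [e e0 eU] : exists2 e, 0 < e & forall z, enorm (o - z) < e -> U z.
  have /nbhs_ballP[e e0 eU] : nbhs o U by exact: open_nbhs_nbhs.
  exists e => // z oz; apply: eU; rewrite -ball_normE /ball_ /=.
  exact: le_lt_trans (norm_le_enorm _) oz.
pose D := enorm o + B; have D0 : 0 < D by rewrite ltr_wpDl ?enorm_ge0.
have r2 : 0 < r ^+ 2 by rewrite exprn_gt0.
(* The terms bound, in units of [ratio x], the steps from [Sw y o] to [Sw y p], on to [Sw x q], and
   on to [Sw x p0]. *)
pose C := D / r ^+ 2 + (kappa + 1) / r + 2 * B.
have C0 : 0 < C.
  rewrite /C; apply: addr_gt0; last by rewrite mulr_gt0.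
  by apply: addr_gt0; apply: divr_gt0 => //; exact: addr_gt0.
have [M packM] := packing d (seq 'I_N) C0 (mulr_gt0 e0 r2).
exists (M + M + M)%N => x [n _ nx].
(* Neighbours are counted level by level, because only words of one level are known to be
   incomparable. *)
pose A m := [set y | level rho m y /\ edges (x, y)].
have AM m : enum_le M (A m).
  apply: (packM _ (fun y => Sw y o) (Sw x p0) (ratio x)).
  - exact: ratio_gt0.
  - move=> y [my xy]; have [_ [_ _ /andP[_ y_le] [p [q [Kp Kq pq]]]]] := edge_neighbour nx xy.
    have h1 := enorm_triangle (Sw y p) (Sw y o) (Sw x p0).
    have h2 := enorm_triangle (Sw x q) (Sw y p) (Sw x p0).
    rewrite !word_map_sim in h1 h2.
    have op : enorm (o - p) <= D.
      by rewrite (le_trans (enormD _ _))// enormN lerD2l KB.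
    have qp : enorm (q - p0) <= 2 * B.
      by rewrite (le_trans (enormD _ _))// enormN mulr2n mulrDl mul1r lerD ?KB.
    have yo : ratio y * enorm (o - p) <= D / r ^+ 2 * ratio x.
      apply: (@le_trans _ _ (ratio x / r ^+ 2 * D)); last by rewrite mulrC mulrA mulrAC.
      by rewrite ler_pM ?enorm_ge0// ltW// ratio_gt0.
    have xq : ratio x * enorm (q - p0) <= 2 * B * ratio x.
      by rewrite mulrC ler_wpM2r// ltW// ratio_gt0.
    rewrite /C [leRHS]mulrDl [X in _ <= X + _]mulrDl.
    apply: (le_trans h1); rewrite -addrA lerD//.
    by apply: (le_trans h2); rewrite lerD.
  - move=> y z [my xy] [mz xz] yz; apply: contrapT => y_neq_z.
    have [_ [_ _ /andP[x_le _] _]] := edge_neighbour nx xy.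
    (* Surjectivity pulls [Sw z o] back by [Sw y] to a point within [e] of [o], hence in [U]; the
       images of [U] under [Sw y] and [Sw z] would meet. *)
    have [p zE] := similitude_surj (ratio_gt0 rho01 y) (word_map_sim y) (Sw z o).
    have Up : U p.
      apply: eU; rewrite -(ltr_pM2l (ratio_gt0 rho01 y)) -word_map_sim zE.
      rewrite (lt_le_trans yz)// -mulrA mulrC ler_wpM2r// ltW//.
    apply: (word_map_disjoint SU tU _ _ Up Uo zE).
    + by apply/negP => /(level_antichain rho01 my mz).
    + by apply/negP => /(level_antichain rho01 mz my)/esym.
apply: sub_enum_le (enum_leU (enum_leU (AM n) (AM n.+1)) (AM n.-1)) => y xy.
have [m [my mn _ _]] := edge_neighbour nx xy.
by case: mn => mE; rewrite -mE; [left; left|left; right|right].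
Qed.

(** * Bounded degree implies the open set condition *)

Definition near_words k : set (seq 'I_N) := [set i | exists w a,
  [/\ i = rcons w a, ratio i <= ratio k < ratio w &
    exists p q, [/\ K p, K q & enorm (Sw i p - Sw k q) <= kappa * ratio k]]].

(** Prefixing [u] scales all ratios and distances involved by the same factor [ratio u]. *)
Lemma near_words_cat u k : near_words k `<=` [set i | near_words (u ++ k) (u ++ i)].
Proof.
move=> _ [w [a [-> /andP[ik kw] [p [q [Kp Kq pq]]]]]].
have u0 := ratio_gt0 rho01 u; exists (u ++ w), a; split.
- by rewrite rcons_cat.
- by rewrite !ratio_cat ler_pM2l// ltr_pM2l// ik.
exists p, q; split=> //.
by rewrite !word_map_cat word_map_sim ratio_cat mulrCA ler_pM2l.
Qed.

(** At the level [n] of the scale of [k], the prefix [u] of a near word is the prefix [k1] of [k] or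
    a horizontal neighbour of it, giving [M.+1] choices. The rest of the word has ratio above
    [r ^+ 2]: one factor [r] comes from the scale of [k], one from the last letter. *)
Lemma near_words_bounded : bounded_degree R (vertices rho) edges ->
  exists M, forall k, enum_le M (near_words k).
Proof.
move=> /bounded_degreeP[M edgeM].
have [L [W WL Wr]] := enum_large_words rho01 (exprn_gt0 2 r_gt0).
exists (M.+1 * L)%N => k.
have [n /andP[nk kn]] := ratio_scale rho01 k N_gt0.
have [k1 [k2 [kE nk1]]] := level_prefix rho01 N_gt0 kn.
have [|s sM es] := edgeM k1; first by exists n.
exists [seq u ++ v | u <- k1 :: s, v <- W].
  by rewrite size_allpairs leq_mul.
move=> i [w [a [iE /andP[ik kw] [p [q [Kp Kq pq]]]]]].
have [u [v [uvE nu]]] := level_prefix rho01 N_gt0 (le_trans ik kn).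
have /andP[_ un] := level_ratio rho01 N_gt0 nu.
apply/allpairsP; exists (u, v) => /=; split=> //.
- rewrite inE; have [->//|/eqP uk1 /=] := eqVneq u k1.
  apply: es; right; exists n; split=> //=; first exact/nesym.
  apply: (@le_trans _ _ (enorm (Sw k1 (Sw k2 q) - Sw u (Sw v p)))).
    by apply: set_dist_le; [exists (Sw k2 q)|exists (Sw v p)] => //;
      exact: word_map_stable.
  rewrite enormB -!word_map_cat -kE -uvE (le_trans pq)//.
  by rewrite ler_wpM2l// ltW.
- apply: Wr => /=; rewrite -(ltr_pM2l (ratio_gt0 rho01 u)) -ratio_cat -uvE iE.
  apply: le_lt_trans (ratio_rcons_gt rho01 a kw).
  rewrite expr2 mulrA ler_wpM2r ?(ltW r_gt0)//; apply: le_trans (ltW nk).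
  by rewrite exprSr ler_wpM2r// ltW.
Qed.

(* A word [k] with the maximal number of near words: since [u ++ -] embeds
   [near_words k] into [near_words (u ++ k)], it is onto. *)
Lemma near_words_stable : bounded_degree R (vertices rho) edges ->
  exists k, forall u i, near_words (u ++ k) i -> prefix u i.
Proof.
move=> /near_words_bounded[M near_le].
pose P n := `[< exists k s, [/\ uniq s, size s = n & [set` s] `<=` near_words k] >].
have P0 : exists n, P n by exists 0%N; apply/asboolP; exists [::], [::].
have P_le n : P n -> (n <= M)%N.
  move=> /asboolP[k [s [us <- sk]]]; have [t tM kt] := near_le k.
  by rewrite (leq_trans _ tM)//; apply: uniq_leq_size => // x /sk /kt.
case: (ex_maxnP P0 P_le) => n /asboolP[k [s [us sn sk]]] max_n.
exists k => u i ki; apply: contrapT => ui.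
have : P n.+1.
  apply/asboolP; exists (u ++ k), (i :: [seq u ++ j | j <- s]); split.
  - rewrite /= map_inj_uniq ?us ?andbT; last first.
      by move=> x y /eqP; rewrite eqseq_cat// eqxx => /eqP.
    by apply/mapP => -[j _ iE]; apply: ui; rewrite iE prefix_prefix.
  - by rewrite /= size_map sn.
  - move=> j; rewrite /= inE => /predU1P[->//|/mapP[l ls ->]].
    exact/near_words_cat/sk.
by move=> /max_n; rewrite ltnn.
Qed.

Lemma bounded_degree_osc :
  bounded_degree R (vertices rho) edges -> open_set_condition S.
Proof.
move=> /near_words_stable[k k_stable]; have [_ [p0 Kp0] _] := K_ss.
have [B B0 KB] := attractor_bounded.
(* If the points were closer, cutting [b :: v ++ k] at the ratio of [a :: u ++ k] would give a near
   word of the latter; by the choice of [k] it would start with [a]. *)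
have sep a b u v p q : a <> b -> K p -> K q ->
    ratio (b :: v ++ k) <= ratio (a :: u ++ k) ->
    kappa * ratio (a :: u ++ k) < enorm (Sw (a :: u ++ k) p - Sw (b :: v ++ k) q).
  move=> ab Kp Kq ba; rewrite ltNge; apply/negP => close.
  have lt1 : ratio (a :: u ++ k) < 1 by exact: ratio_lt1.
  have [w [c [t [bE wc]]]] := cut_prefix lt1 ba.
  have : near_words ((a :: u) ++ k) (rcons w c).
    exists w, c; split=> //; exists (Sw t q), p; split=> //.
      exact: word_map_stable.
    by rewrite enormB -word_map_cat -bE.
  move=> /k_stable/prefixP[i iE]; move: bE; rewrite iE => -[ba' _].
  by apply: ab.
(* With the factor [kappa / 2], two radii add up to at most [kappa] times the larger ratio, which is
   the gap given by [sep]. *)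
pose ball_u u p : set 'rV[R]_d :=
  [set z | enorm (z - Sw (u ++ k) p) < kappa / 2 * ratio (u ++ k)].
exists (\bigcup_u \bigcup_(p in K) ball_u u p); split.
- exists (kappa / 2 + B); split; first exact: num_real.
  move=> t Bt z [u _ [p Kp zp]]; apply/ltW/(le_lt_trans _ Bt).
  rewrite (le_trans (norm_le_enorm _))// -[z](subrK (Sw (u ++ k) p)).
  rewrite (le_trans (enormD _ _))// lerD//; last exact/KB/word_map_stable.
  rewrite (le_trans (ltW zp))// ler_piMr ?ratio_le1//.
  by rewrite divr_ge0// ltW.
- exists (Sw k p0), [::] => //; exists p0 => //.
  by rewrite /ball_u /= subrr enorm0 mulr_gt0 ?divr_gt0// ratio_gt0.
- apply: bigcup_open => u _; apply: bigcup_open => p _.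
  rewrite openE => z zp; rewrite /interior /=; apply/nbhs_ballP.
  (* The topology uses sup-norm balls; dividing the remaining slack by [d.+1] fits such a ball into
     the Euclidean one. *)
  pose e := (kappa / 2 * ratio (u ++ k) - enorm (z - Sw (u ++ k) p)) / d.+1%:R.
  have e0 : 0 < e by rewrite divr_gt0// subr_gt0.
  exists e => //= y; rewrite -ball_normE /ball_ /= => zy.
  apply: le_lt_trans (enorm_triangle z _ _) _; rewrite -ltrBrDr enormB.
  apply: le_lt_trans (enorm_le_norm _) _.
  have -> : kappa / 2 * ratio (u ++ k) - enorm (z - Sw (u ++ k) p) = d.+1%:R * e.
    by rewrite [RHS]mulrC divfK.
  apply: (@le_lt_trans _ _ (d.+1%:R * `|z - y|)); last by rewrite ltr_pM2l.
  by rewrite ler_wpM2r// ler_nat.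
- move=> _ [a _ [z [u _ [p Kp zp]] <-]]; exists (a :: u) => //; exists p => //.
  have /andP[a0 _] := rho01 a; have [_ Sa] := S_sim a.
  by rewrite /ball_u /= Sa ratio_cons mulrCA ltr_pM2l.
- move=> a b _ _ [_ [[z1 [u _ [p Kp zp]] <-] [z2 [v _ [q Kq zq]] zE]]].
  apply: contrapT => ab.
  have [_ Sa] := S_sim a; have [_ Sb] := S_sim b.
  have /andP[a0 _] := rho01 a; have /andP[b0 _] := rho01 b.
  have {}zp : enorm (S a z1 - Sw (a :: u ++ k) p) < kappa / 2 * ratio (a :: u ++ k).
    by rewrite /= Sa ratio_cons mulrCA ltr_pM2l.
  have {}zq : enorm (S a z1 - Sw (b :: v ++ k) q) < kappa / 2 * ratio (b :: v ++ k).
    by rewrite -zE /= Sb ratio_cons mulrCA ltr_pM2l.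
  have := enorm_triangle (S a z1) (Sw (a :: u ++ k) p) (Sw (b :: v ++ k) q).
  rewrite [enorm (Sw _ p - S a z1)]enormB.
  have k2 : 0 <= kappa / 2 by rewrite divr_ge0// ltW.
  (* [sep] is applied with the word of larger ratio first. *)
  have [ba|/ltW ba] := leP (ratio (b :: v ++ k)) (ratio (a :: u ++ k)).
    have := sep a b u v p q ab Kp Kq ba; have := ler_wpM2l k2 ba; lra.
  have := sep b a v u q p (nesym ab) Kq Kp ba; have := ler_wpM2l k2 ba.
  rewrite [enorm (_ - Sw (a :: _) _)]enormB; lra.
Qed.

End IteratedFunctionSystem.

Theorem theorem1p4 (R : realType) (d N : nat) (d_gt0 : (0 < d)%N)
    (N_gt0 : (0 < N)%N) (S : 'I_N -> 'rV[R]_d -> 'rV[R]_d) (rho : 'I_N -> R)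
    (S_sim : forall j, contractive_similitude (rho j) (S j))
    (K : set 'rV[R]_d) (K_ss : self_similar_set S K)
    (kappa : R) (kappa_gt0 : 0 < kappa) :
  bounded_degree R (vertices rho) (augmented_tree_edges S rho K kappa)
  <-> open_set_condition S.
Proof.
split; first exact: bounded_degree_osc.
exact: osc_bounded_degree.
Qed.
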